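(* Let $f:S^1\to S^1$ be an order-preserving map of the circle whose rotation number is of bounded type. Suppose that $f$ is $C^1$ except possibly at a finite number of points, and that the variation $\mathrm{var}_{\mathrm{supp}(\mathrm{D}f)}\log \mathrm{D}f$ is finite. Then either $f$ has no forward wandering intervals, or else $f$ has no backward wandering intervals (possibly neither kind exists).
   Context: $S^1$ is the unit circle with orientation and metric induced by the canonical projection $\pi:\mathbb{R}\to S^1$, $\pi(x)=x \pmod 1$. A function $f:S^1\to S^1$ is an order-preserving map if there is a non-decreasing map $F:\mathbb{R}\to\mathbb{R}$ with $F(x+1)=F(x)+1$ for all $x$ and $\pi\circ F=f\circ\pi$. Order-preserving maps are not assumed continuous, injective or surjective. The rotation number of $f$ is $\lim_{n\to\infty}(F^n(x)-x)/n \pmod 1$ (independent of $x$). A number $\alpha$ is of bounded type if it is irrational and the coefficients $a_n$ of its continued fraction expansion $\alpha=[a_0,a_1,a_2,\ldots]$ are bounded. $\mathrm{D}f$ is the derivative of $f$, and $\mathrm{supp}(\mathrm{D}f)$ is the set of points where $\mathrm{D}f$ is defined and non-zero, so that $\log\mathrm{D}f$ is real-valued on it. For $g:U\to\mathbb{R}$, $U\subset S^1$, $\mathrm{var}_U(g)=\sup\sum_{i=1}^n|g(x_i)-g(x_{i-1})|$, the supremum being over all finite ordered sets $x_0<\cdots<x_n$ of points in $U$. An interval $I\subset S^1$ is forward wandering (respectively backward wandering) for $f$ if the sets $f^k(I)$, for integers $k\ge 0$ (respectively $k\le 0$, where $f^{k}(I)$ for $k<0$ denotes the preimage of $I$ under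 $f^{|k|}$), are pairwise disjoint intervals not reduced to a point, and the $\omega$-limit set (respectively $\alpha$-limit set) of $I$ is not a periodic orbit. *)

(* Defs.v *)
From HB Require Import structures.
From mathcomp Require Import all_boot all_order all_algebra.
From mathcomp Require Import all_classical all_reals all_analysis.

Set Implicit Arguments.
Unset Strict Implicit.
Unset Printing Implicit Defensive.

Import Order.TTheory GRing.Theory Num.Theory.
Import numFieldNormedType.Exports.

Local Open Scope classical_set_scope.
Local Open Scope ring_scope.
Local Open Scope quotient_scope.

(** Congruence modulo 1. *)
Definition modZ (R : realType) (x y : R) : bool := x - y \is a Num.int.

Lemma modZ_refl (R : realType) : reflexive (@modZ R).
Proof. by move=> x; rewrite /modZ subrr rpred0. Qed.

Lemma modZ_sym (R : realType) : symmetric (@modZ R).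
Proof. by move=> x y; rewrite /modZ -opprB rpredN. Qed.

Lemma modZ_trans (R : realType) : transitive (@modZ R).
Proof.
by move=> y x z xy yz; rewrite /modZ -(subrK y x) -addrA rpredD.
Qed.

Canonical modZ_equiv (R : realType) : equiv_rel R :=
  EquivRel (@modZ R) (@modZ_refl R) (@modZ_sym R) (@modZ_trans R).

(** The circle R/Z, with the quotient topology. *)
Definition circle (R : realType) := quotient_topology {eq_quot (modZ_equiv R)}.

HB.instance Definition _ (R : realType) := Topological.on (circle R).

Definition cproj (R : realType) (x : R) : circle R :=
  \pi_(circle R) x.

Lemma cproj_eqP (R : realType) (x y : R) :
  cproj x = cproj y <-> x - y \is a Num.int.
Proof. by split => [/eqmodP|xy]; [|apply/eqmodP]. Qed.

Lemma cproj_surj (R : realType) (p : circle R) : exists x : R, cproj x = p.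
Proof. by exists (repr p); exact: reprK. Qed.

Definition order_preserving_lift (R : realType)
    (f : circle R -> circle R) (F : R -> R) : Prop :=
  [/\ {homo F : x y / x <= y},
      forall x, F (x + 1) = F x + 1 &
      forall x, cproj (F x) = f (cproj x)].

Definition order_preserving (R : realType) (f : circle R -> circle R) : Prop :=
  exists F : R -> R, order_preserving_lift f F.

Definition is_rotation_number (R : realType)
    (f : circle R -> circle R) (a : circle R) : Prop :=
  exists (F : R -> R) (r : R),
    [/\ order_preserving_lift f F,
        forall x, (iter n F x - x) / n%:R @[n --> \oo] --> r &
        cproj r = a].

(** [cf_quotient alpha n] is the [n]-th complete quotient of [alpha]; these are
    the usual ones as long as no complete quotient is an integer, hence for all
    [n] when [alpha] is irrational. *)
Definition cf_quotient (R : realType) (alpha : R) (n : nat) : R :=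
  iter n (fun x => (x - (Num.floor x)%:~R)^-1) alpha.

Definition cf_coef (R : realType) (alpha : R) (n : nat) : int :=
  Num.floor (cf_quotient alpha n).

Definition bounded_type (R : realType) (alpha : R) : Prop :=
  @irrational R alpha /\
  exists M : int, forall n : nat, `|cf_coef alpha n| <= M.

(** The derivative at [p] is computed in the charts given by [cproj]: [G] is a
    local expression of [f] near a representative [x] of [p].  The local lift
    [G] is not required to be globally defined, periodic or monotone; its
    derivability at [x] forces it to be continuous at [x], so that [l] does not
    depend on [G] and [x]. *)
Definition has_cderiv (R : realType)
    (f : circle R -> circle R) (p : circle R) (l : R) : Prop :=
  exists (x : R) (G : R -> R),
    [/\ cproj x = p,
        \forall y \near x, cproj (G y) = f (cproj y) &
        is_derive x 1 G l].

Definition cderivable (R : realType)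
    (f : circle R -> circle R) (p : circle R) : Prop :=
  exists l : R, has_cderiv f p l.

(** Takes the junk value [0] where [f] is not differentiable. *)
Definition cderiv (R : realType)
    (f : circle R -> circle R) (p : circle R) : R :=
  xget 0 [set l : R | has_cderiv f p l].

Definition C1_except_finite (R : realType) (f : circle R -> circle R) : Prop :=
  exists E : set (circle R), finite_set E /\
    forall p, ~ E p -> cderivable f p /\ {for p, continuous (cderiv f)}.

Definition supp_cderiv (R : realType) (f : circle R -> circle R) :
    set (circle R) :=
  [set p | cderivable f p /\ cderiv f p != 0].

(** A finite ordered set [x_0 < ... < x_n] of points of the circle is one that
    lifts to reals [t_0 < ... < t_n < t_0 + 1]. *)
Definition ordered_points (R : realType) (U : set (circle R))
    (n : nat) (t : nat -> R) : Prop :=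
  [/\ forall i, (i < n)%N -> t i < t i.+1,
      t n < t 0%N + 1 &
      forall i, (i <= n)%N -> U (cproj (t i))].

Definition cvariation (R : realType) (U : set (circle R))
    (g : circle R -> R) : \bar R :=
  ereal_sup [set v : \bar R | exists (n : nat) (t : nat -> R),
    ordered_points U n t /\
    v = (\sum_(1 <= i < n.+1)
           `|g (cproj (t i)) - g (cproj (t i.-1))|)%:E].

Definition nontrivial_cinterval (R : realType) (A : set (circle R)) : Prop :=
  (exists J : set R, is_interval J /\ A = @cproj R @` J) /\
  (exists p q, [/\ A p, A q & p <> q]).

Definition periodic_orbit (R : realType) (f : circle R -> circle R)
    (O : set (circle R)) : Prop :=
  exists (p : circle R) (q : nat),
    [/\ (0 < q)%N, iter q f p = p & O = range (fun k : nat => iter k f p)].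

(** Set of accumulation points of a sequence of sets: the points all of whose
    neighbourhoods meet infinitely many of the [A k]. *)
Definition limit_set (R : realType) (A : nat -> set (circle R)) :
    set (circle R) :=
  \bigcap_(n in [set: nat]) closure (\bigcup_(k in [set k | (n <= k)%N]) A k).

Definition fwd (R : realType) (f : circle R -> circle R) (I : set (circle R))
    (k : nat) : set (circle R) := iter k f @` I.

Definition bwd (R : realType) (f : circle R -> circle R) (I : set (circle R))
    (k : nat) : set (circle R) := iter k f @^-1` I.

Definition wandering_sequence (R : realType) (f : circle R -> circle R)
    (A : nat -> set (circle R)) : Prop :=
  [/\ forall k, nontrivial_cinterval (A k),
      trivIset [set: nat] A &
      ~ periodic_orbit f (limit_set A)].

Definition forward_wandering (R : realType) (f : circle R -> circle R)
    (I : set (circle R)) : Prop := wandering_sequence f (fwd f I).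

Definition backward_wandering (R : realType) (f : circle R -> circle R)
    (I : set (circle R)) : Prop := wandering_sequence f (bwd f I).

(* Main.v *)
Require Import Defs.
From mathcomp Require Import all_boot all_order all_algebra.
From mathcomp Require Import all_classical all_reals all_analysis.
From mathcomp Require Import zify ring lra.

(** Let [F] be a lift of [f] and [rho] its (irrational) translation number. As for
    every order-preserving map there is a nondecreasing [h] that commutes with
    integer translations and satisfies [h (F x) = h x + rho]
    ([rotation_semiconjugacy]). The rotation is minimal, so [h] is constant on an
    interval whose iterates do not come back to it. A forward wandering interval
    therefore makes all fibers [h = c + k rho], [k >= 0], nondegenerate, and a
    backward wandering interval makes all fibers [h = d - k rho] nondegenerate.
    Fibers over distinct points of the circle are disjoint, so after a shift of
    [c] and [d] these fibers avoid the finitely many exceptional points of [f].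

    On such a fiber [F] maps end points to end points, and the mean value theorem
    expresses the growth of the logarithm of the length, from the fiber over [t]
    to the one over [t + rho], as a value [ln Df (x)] at a point [x] of the fiber
    where [Df] is positive ([fiber_step], [ln_fiber_length_step]).

    If both kinds of wandering intervals exist, take [q] with [|q rho - p| < 1/q]
    and [p], [q] coprime. Over [q] steps the forward lengths change by a sum of
    [ln Df] over [q] points [x_i] with [h x_i = c + i rho], and the backward
    lengths by the sum over [q] points [y_i] with [h y_i = d - rho - i rho]. Modulo
    [1] both families of values of [h] are a perturbed progression of step [1/q]
    ([rotation_bins]), so the points can be paired within arcs that overlap at
    most three times, and the two sums differ by at most [5 V], where [V] is the
    variation of [ln Df] ([rotation_sums_close]). In other words
    [length (c + q rho) * length (d - q rho) >=
     length c * length d * exp (- 5 V)].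
    The second factor is at most [1], so the fiber over [c + q rho] has a length
    bounded below. But [q rho] can be chosen arbitrarily close to [0] modulo [1],
    and fibers close to the fiber over [c] and different from it are short
    ([near_fiber_short]): a contradiction. *)

Set Implicit Arguments.
Unset Strict Implicit.
Unset Printing Implicit Defensive.

Import Order.TTheory GRing.Theory Num.Theory.
Import numFieldNormedType.Exports.

Local Open Scope classical_set_scope.
Local Open Scope ring_scope.

(** * Rational approximation *)

Lemma irrational_mul_nint (R : realType) (rho : R) (n : nat) :
  @irrational R rho -> (0 < n)%N -> n%:R * rho \isn't a Num.int.
Proof.
move=> irr n0; apply/negP => /intrP[m nrho]; apply: irr.
exists (m%:~R / n%:R) => //.
by rewrite fmorph_div/= ratr_int ratr_nat -nrho mulrC mulKf// pnatr_eq0 -lt0n.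
Qed.

Lemma irrational_inj (R : realType) (rho : R) (m n : nat) :
  @irrational R rho -> m%:R * rho - n%:R * rho \is a Num.int -> m = n.
Proof.
move=> irr; wlog mn : m n / (m < n)%N => [wl mnZ|].
  case: (ltngtP m n) => // [/wl|/wl wl']; first exact.
  by apply/esym/wl'; rewrite -opprB rpredN.
rewrite -opprB rpredN -mulrBl -natrB; last exact: ltnW.
move=> nmZ; have nm0 : (0 < n - m)%N by rewrite subn_gt0.
by have /negP := irrational_mul_nint irr nm0.
Qed.

Lemma int_lt1_eq0 (R : realType) (x : R) : x \is a Num.int -> `|x| < 1 -> x = 0.
Proof.
move=> /intrP[m ->]; rewrite -intr_norm -[1]/(1%:~R) ltr_int => m1.
by have -> : m = 0 by lia.
Qed.

(** Pigeonhole: among the fractional parts of [0, rho, ..., N rho] two lie in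
    the same of the [N] arcs of length [1/N]. *)
Lemma dirichlet_pigeonhole (R : realType) (rho : R) (N : nat) : (0 < N)%N ->
  exists (q : nat) (p : int),
    [/\ (0 < q)%N, (q <= N)%N & `|q%:R * rho - p%:~R| < N%:R^-1].
Proof.
case: N => // N _.
pose fr (i : nat) : R := i%:R * rho - (Num.floor (i%:R * rho))%:~R.
have fr0 i : 0 <= fr i by rewrite subr_ge0 floor_le_tmp.
have fr1 i : fr i < 1 by rewrite ltrBlDr addrC -intrD1 floorD1_gt.
pose b (i : 'I_N.+2) : 'I_N.+1 := inord (Num.truncn (N.+1%:R * fr i)).
have /injectivePn[i [j ij bij]] : ~~ injectiveb b.
  by apply/negP => /injectiveP /leq_card; rewrite !card_ord ltnn.
wlog ltij : i j ij bij / (i < j)%N => [wl|].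
  case: (ltngtP i j) => [||/val_inj eqij]; [exact: wl| |].
  - by apply: wl; rewrite 1?eq_sym.
  - by rewrite eqij eqxx in ij.
have bE (k : 'I_N.+2) : (b k : nat) = Num.truncn (N.+1%:R * fr k).
  rewrite /b inordK// -(ltr_nat R); apply: (@le_lt_trans _ _ (N.+1%:R * fr k)).
    by rewrite truncn_le mulr_ge0.
  by rewrite -[ltRHS]mulr1 ltr_pM2l.
have bnd (k : 'I_N.+2) : (b k)%:R <= N.+1%:R * fr k < (b k).+1%:R.
  by rewrite bE truncn_le ?truncnS_gt// mulr_ge0.
exists (j - i)%N, (Num.floor (j%:R * rho) - Num.floor (i%:R * rho)); split.
- by rewrite subn_gt0.
- by have := ltn_ord j; lia.
have -> : (j - i)%:R * rho - (Num.floor (j%:R * rho) - Num.floor (i%:R * rho))%:~R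
   = fr j - fr i.
  by rewrite natrB 1?ltnW// /fr intrB; ring.
rewrite -[ltRHS]mul1r ltr_pdivlMr// -[X in _ * X]ger0_norm// -normrM mulrC.
rewrite mulrBr; have := bnd i; have := bnd j.
rewrite -bij -(natr1 (b i)); move: (_ * fr i) (_ * fr j) => u v.
move: ((b i : nat)%:R : R) => w /andP[? ?] /andP[? ?].
by rewrite ltr_norml; apply/andP; split; lra.
Qed.

(** Coprimality costs nothing: dividing [p] and [q] by their gcd shrinks
    [|q rho - p|] and enlarges [1/q]. *)
Lemma dirichlet (R : realType) (rho eta : R) : 0 < eta ->
  exists (q : nat) (p : int),
    [/\ (0 < q)%N, coprimez p q, `|q%:R * rho - p%:~R| < q%:R^-1 &
        `|q%:R * rho - p%:~R| < eta].
Proof.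
move=> eta0; pose N := (Num.truncn eta^-1).+1.
have Neta : N%:R^-1 < eta by rewrite invf_plt ?posrE// truncnS_gt.
have [q [p [q0 qN qp]]] := @dirichlet_pigeonhole R rho N isT.
have gdq := dvdz_gcdr p q; have gdp := dvdz_gcdl p q.
have g0 : 0 < gcdz p q by rewrite /gcdz ltz_nat gcdn_gt0 absz_nat q0 orbT.
pose q' := `|(q %/ gcdz p q)%Z|%N; pose p' := (p %/ gcdz p q)%Z.
have qE : (q : int) = gcdz p q * q'.
  by rewrite gez0_abs ?divz_ge0// mulrC divzK.
have pE : p = gcdz p q * p' by rewrite mulrC divzK.
have q'0 : (0 < q')%N by case: q' qE => //; lia.
have q'q : (q' <= q)%N.
  rewrite -lez_nat qE; move: g0; move: (gcdz p q) => g; nia.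
have cop : coprimez p' q'.
  have : gcdz p q * gcdz p' q' = gcdz p q.
    by rewrite -{1}(gtz0_abs g0) mulz_gcdr -pE -qE.
  rewrite /coprimez; move: g0; move: (gcdz p q) (gcdz p' q') => a b; nia.
have qR : q%:R = (gcdz p q)%:~R * q'%:R :> R.
  by rewrite [LHS]pmulrn [in LHS]qE intrM.
have pR : p%:~R = (gcdz p q)%:~R * p'%:~R :> R by rewrite -intrM -pE.
have small : `|q'%:R * rho - p'%:~R| < N%:R^-1.
  apply: le_lt_trans qp.
  have -> : q%:R * rho - p%:~R = (gcdz p q)%:~R * (q'%:R * rho - p'%:~R) :> R.
    by rewrite qR pR; ring.
  rewrite normrM ler_peMl// -intr_norm -[1]/(1%:~R) ler_int; lia.
exists q', p'; split => //.
- apply: lt_le_trans small _; rewrite lef_pV2 ?posrE ?ltr0n// ler_nat.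
  exact: leq_trans qN.
- exact: lt_trans Neta.
Qed.

(** * Poincare semiconjugacy *)

Definition degree_one (R : realType) (F : R -> R) : Prop :=
  {homo F : x y / x <= y} /\ forall x, F (x + 1) = F x + 1.

Lemma degree_oneZ (R : realType) (F : R -> R) (m : int) (x : R) :
  degree_one F -> F (x + m%:~R) = F x + m%:~R.
Proof.
move=> [_ F1]; have Fn (n : nat) y : F (y + n%:R) = F y + n%:R.
  by elim: n => [|n IH]; rewrite ?addr0// -natr1 !addrA F1 IH.
case: m => n; first exact: Fn.
by rewrite NegzE intrN; apply: (addIr n.+1%:R); rewrite -Fn !subrK.
Qed.

Lemma degree_one_iter (R : realType) (F : R -> R) (n : nat) :
  degree_one F -> degree_one (iter n F).
Proof.
move=> [Fmono F1]; split; elim: n => //= n IH.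
- by move=> x y /IH /Fmono.
- by move=> x; rewrite IH F1.
Qed.

Lemma degree_one_ge_iter (R : realType) (G : R -> R) (m : int) (x : R) (k : nat) :
  degree_one G -> x + m%:~R <= G x -> x + k%:R * m%:~R <= iter k G x.
Proof.
move=> dG xG; elim: k => [|k IH]; first by rewrite mul0r addr0.
have -> : x + k.+1%:R * m%:~R = x + m%:~R + (k%:Z * m)%:~R.
  by rewrite intrM -natr1; ring.
rewrite iterS; apply: (@le_trans _ _ (G (x + (k%:Z * m)%:~R))).
  by rewrite degree_oneZ// lerD2r.
by apply: dG.1; rewrite intrM.
Qed.

Lemma degree_one_le_iter (R : realType) (G : R -> R) (m : int) (x : R) (k : nat) :
  degree_one G -> G x <= x + m%:~R -> iter k G x <= x + k%:R * m%:~R.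
Proof.
move=> dG xG; elim: k => [|k IH]; first by rewrite mul0r addr0.
have -> : x + k.+1%:R * m%:~R = x + m%:~R + (k%:Z * m)%:~R.
  by rewrite intrM -natr1; ring.
rewrite iterS; apply: (@le_trans _ _ (G (x + (k%:Z * m)%:~R))).
  by apply: dG.1; rewrite intrM.
by rewrite degree_oneZ// lerD2r.
Qed.

Definition translation_number (R : realType) (F : R -> R) (rho : R) : Prop :=
  forall x, (iter n F x - x) / n%:R @[n --> \oo] --> rho.

(** The displacement [F^n x - x] is almost additive in [n]: if it is at least
    an integer [m] then the displacement of [F^(kn)] is at least [km]. Hence it
    stays within [1] of [n rho]. *)
Lemma translation_number_iter_close (R : realType) (F : R -> R) (rho : R)
    (n : nat) (x : R) :
  degree_one F -> translation_number F rho -> `|iter n F x - x - n%:R * rho| <= 1.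
Proof.
move=> dF Frho; case: n => [|n]; first by rewrite /= subrr mul0r subrr normr0.
have sub : (iter (k * n.+1) F x - x) / (k * n.+1)%:R @[k --> \oo] --> rho.
  apply: (cvg_comp (fun k => (k * n.+1)%N)
    (fun j => (iter j F x - x) / j%:R) _ (Frho x)).
  apply/cvgnyPge => A; near=> k.
  by rewrite (leq_trans (_ : (A <= k)%N)) ?leq_pmulr//; near: k; exact: nbhs_infty_ge.
have dG := degree_one_iter n.+1 dF.
have iterE k : iter (k * n.+1) F x = iter k (iter n.+1 F) x by rewrite iterM.
pose m := Num.floor (iter n.+1 F x - x).
have lo : m%:~R <= n.+1%:R * rho.
  rewrite mulrC -ler_pdivrMr//; apply: (cvgr_to_ge sub).
  near=> k; rewrite iterE natrM ler_pdivlMr; last first.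
    by rewrite mulr_gt0 ?ltr0n//; near: k; exact: nbhs_infty_gt.
  rewrite mulrCA divfK ?pnatr_eq0//.
  rewrite lerBrDl; apply: degree_one_ge_iter => //.
  by rewrite -lerBrDl floor_le.
have hi : n.+1%:R * rho <= m%:~R + 1.
  rewrite mulrC -ler_pdivlMr//; apply: (cvgr_to_le sub).
  near=> k; rewrite iterE natrM ler_pdivrMr; last first.
    by rewrite mulr_gt0 ?ltr0n//; near: k; exact: nbhs_infty_gt.
  rewrite mulrCA divfK ?pnatr_eq0//.
  rewrite lerBlDl -intrD1; apply: degree_one_le_iter => //.
  by rewrite -lerBlDl ltW// floorD1_gt.
have := floor_itv (iter n.+1 F x - x); rewrite -/m intrD1 => /andP[? ?].
by rewrite ler_norml; apply/andP; split; lra.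
Unshelve. all: by end_near. Qed.

Lemma le_sup_translate (R : realType) (A B : set R) (c : R) :
  A !=set0 -> has_ubound B -> (forall t, A t -> B (t + c)) -> sup A + c <= sup B.
Proof.
move=> A0 Bub AB; rewrite -lerBrDr; apply: ge_sup => // t At.
by rewrite lerBrDr; apply: ub_le_sup => //; exact: AB.
Qed.

(** Poincare's semiconjugacy onto the rotation, as
    [h x = liminf (F^n x - n rho)]. A limit inferior turns
    [F^n (F x) - n rho = (F^(n+1) x - (n+1) rho) + rho] into an exact relation. *)
Lemma rotation_semiconjugacy (R : realType) (F : R -> R) (rho : R) :
  degree_one F -> translation_number F rho ->
  exists h : R -> R, degree_one h /\ forall x, h (F x) = h x + rho.
Proof.
move=> dF Frho.
pose S x := [set t | exists N, forall n, (N <= n)%N -> t <= iter n F x - n%:R * rho].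
have close n x := translation_number_iter_close n x dF Frho.
have S0 x : S x !=set0.
  exists (x - 1), 0%N => n _; have := close n x; rewrite ler_norml => /andP[].
  by lra.
have Sub x : has_ubound (S x).
  exists (x + 1) => t [N /(_ N (leqnn N))]; have := close N x.
  by rewrite ler_norml => /andP[]; lra.
have shift x y c : (forall t, S x t -> S y (t + c)) ->
    (forall t, S y t -> S x (t - c)) -> sup (S y) = sup (S x) + c.
  move=> xy yx; apply/eqP; rewrite eq_le le_sup_translate// andbT.
  by rewrite -lerBlDr le_sup_translate.
exists (sup \o S); split; first split=> [x y xy|x] /=.
- rewrite -[leLHS]addr0; apply: le_sup_translate => // t [N tN].
  exists N => n /tN; rewrite addr0 => /le_trans; apply.
  by rewrite lerD2r; apply: (degree_one_iter n dF).1.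
- apply: shift => t [N tN]; exists N => n /tN;
    rewrite (degree_one_iter n dF).2; lra.
- move=> x /=; apply: shift => t [N tN].
  + exists N => n Nn; have := tN n.+1 (leqW Nn); rewrite iterSr -natr1; lra.
  + exists N.+1 => -[//|n] /tN; rewrite iterSr -natr1; lra.
Qed.

(** * Fibers of the semiconjugacy *)

Section Fibers.
Variables (R : realType) (F h : R -> R) (rho : R).
Hypotheses (dF : degree_one F) (dh : degree_one h).
Hypotheses (hF : forall x, h (F x) = h x + rho) (irr : @irrational R rho).

Lemma fiber_lt x y : h x < h y -> x < y.
Proof. by rewrite !ltNge; apply: contraNN => /dh.1. Qed.

Lemma fiber_iter n x : h (iter n F x) = h x + n%:R * rho.
Proof.
elim: n => [|n IH]; first by rewrite mul0r addr0.
by rewrite iterS hF IH -natr1; ring.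
Qed.

(** The rotation is minimal: some [n rho + m] with [n > 0] is smaller in
    absolute value than [h y - h x], and one adds it to [h x] or to [h y]
    according to its sign. *)
Lemma orbit_between x y : h x < h y ->
  exists (n : nat) (m : int) (z : R),
    [/\ (0 < n)%N, z = x \/ z = y & h x < h (iter n F z + m%:~R) < h y].
Proof.
move=> xy; have eta0 : 0 < h y - h x by rewrite subr_gt0.
have [q [p [q0 _ _ qp]]] := dirichlet rho eta0.
have E z : h (iter q F z + (- p)%:~R) = h z + (q%:R * rho - p%:~R).
  by rewrite degree_oneZ// fiber_iter intrN; ring.
have : q%:R * rho - p%:~R != 0.
  rewrite subr_eq0; apply: contra (irrational_mul_nint irr q0) => /eqP ->.
  exact: intr_int.
move: qp; set e := _ - _ => qp; rewrite neq_lt => /orP[e0|e0].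
- exists q, (- p), y; split=> //; first by right.
  by move: qp; rewrite E -/e ltr0_norm// => ?; apply/andP; split; lra.
- exists q, (- p), x; split=> //; first by left.
  by move: qp; rewrite E -/e gtr0_norm// => ?; apply/andP; split; lra.
Qed.

Definition fiber_lo t := inf [set x | h x = t].
Definition fiber_hi t := sup [set x | h x = t].
Definition fiber_length t := fiber_hi t - fiber_lo t.

Lemma fiber_le_add1 x y : h x = h y -> x <= y + 1.
Proof.
move=> xy; rewrite leNgt; apply/negP => yx; have := dh.1 _ _ (ltW yx).
by rewrite dh.2 xy; lra.
Qed.

Lemma fiber_lo_le z : fiber_lo (h z) <= z.
Proof.
apply: ge_inf => //; exists (z - 1) => x /= xz.
by rewrite lerBlDr fiber_le_add1.
Qed.

Lemma fiber_le_hi z : z <= fiber_hi (h z).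
Proof.
by apply: ub_le_sup => //; exists (z + 1) => x /= xz; exact: fiber_le_add1.
Qed.

(** If [h] were smaller at the infimum than on the fiber, a point with an
    intermediate value of [h] would be a lower bound of the fiber greater than
    its infimum. *)
Lemma h_fiber_lo z : h (fiber_lo (h z)) = h z.
Proof.
apply/eqP; rewrite eq_le dh.1 ?fiber_lo_le//= leNgt; apply/negP => loz.
have [n [m [x [_ _ /andP[]]]]] := orbit_between loz.
set w := _ + _ => low wz.
have := fiber_lt low; rewrite ltNge => /negP; apply.
apply: lb_le_inf => [|y /= yz]; first by exists z.
by apply/ltW/fiber_lt; rewrite yz.
Qed.

Lemma h_fiber_hi z : h (fiber_hi (h z)) = h z.
Proof.
apply/eqP; rewrite eq_le [X in _ && X]dh.1 ?fiber_le_hi// andbT leNgt.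
apply/negP => zhi; have [n [m [x [_ _ /andP[]]]]] := orbit_between zhi.
set w := _ + _ => zw whi.
have := fiber_lt whi; rewrite ltNge => /negP; apply.
apply: ge_sup => [|y /= yz]; first by exists z.
by apply/ltW/fiber_lt; rewrite yz.
Qed.

Lemma fiberP z x : h x = h z <-> fiber_lo (h z) <= x <= fiber_hi (h z).
Proof.
split=> [<-|/andP[lox xhi]]; first by rewrite fiber_lo_le fiber_le_hi.
apply/eqP; rewrite eq_le -[X in (_ <= X) && _]h_fiber_hi.
by rewrite -[X in _ && (X <= _)]h_fiber_lo !dh.1.
Qed.

Lemma fiber_length_gt0 x y : h x = h y -> x <> y -> 0 < fiber_length (h x).
Proof.
have lt_length u v : h u = h v -> u < v -> 0 < fiber_length (h u).
  move=> uv ltuv; rewrite subr_gt0 (le_lt_trans (fiber_lo_le u))//.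
  by rewrite (lt_le_trans ltuv)// uv fiber_le_hi.
move=> xy /eqP; rewrite neq_lt => /orP[|]; first exact: lt_length.
by rewrite xy; exact: lt_length.
Qed.

Lemma fiber_length_le1 z : fiber_length (h z) <= 1.
Proof.
by rewrite lerBlDl fiber_le_add1// h_fiber_hi h_fiber_lo.
Qed.

Lemma fiber_lengthD_int z (m : int) : fiber_length (h z + m%:~R) = fiber_length (h z).
Proof.
have shift x : h (x + m%:~R) = h x + m%:~R by exact: degree_oneZ.
have unshift x : h (x - m%:~R) = h x - m%:~R by rewrite -intrN degree_oneZ.
have lo : fiber_lo (h z + m%:~R) = fiber_lo (h z) + m%:~R.
  apply/eqP; rewrite eq_le -[X in _ && X]lerBrDr; apply/andP; split.
    by rewrite -[X in fiber_lo (X + _)]h_fiber_lo -shift fiber_lo_le.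
  rewrite -shift.
  have : h (fiber_lo (h (z + m%:~R)) - m%:~R) = h z.
    by rewrite unshift h_fiber_lo shift addrK.
  by move=> E; rewrite -[X in fiber_lo X <= _]E fiber_lo_le.
have hi : fiber_hi (h z + m%:~R) = fiber_hi (h z) + m%:~R.
  apply/eqP; rewrite eq_le -[X in X && _]lerBlDr; apply/andP; split.
    rewrite -shift.
    have : h (fiber_hi (h (z + m%:~R)) - m%:~R) = h z.
      by rewrite unshift h_fiber_hi shift addrK.
    by move=> E; rewrite -[X in _ <= fiber_hi X]E fiber_le_hi.
  by rewrite -[X in _ <= fiber_hi (X + _)]h_fiber_hi -shift fiber_le_hi.
by rewrite /fiber_length lo hi; ring.
Qed.

(** A point at distance [C] beyond an end of the fiber of [z] is not in that
    fiber, so its value leaves room for every other fiber close enough; such a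
    fiber is caught within distance [C] of the end. *)
Lemma near_fiber_short z C : 0 < C ->
  exists2 eta, 0 < eta & forall y, h y <> h z -> `|h y - h z| < eta ->
    fiber_length (h y) < C.
Proof.
move=> C0; have /fiberP hiz := h_fiber_hi z; have /fiberP loz := h_fiber_lo z.
have up : h z < h (fiber_hi (h z) + C).
  rewrite lt_neqAle -[X in _ && (X <= _)]h_fiber_hi dh.1 ?lerDl 1?ltW// andbT.
  by apply/eqP => /esym/fiberP /andP[_]; lra.
have down : h (fiber_lo (h z) - C) < h z.
  rewrite lt_neqAle -[X in _ && (_ <= X)]h_fiber_lo dh.1 ?gerBl 1?ltW// andbT.
  by apply/eqP => /fiberP /andP[]; lra.
pose eta := Num.min (h (fiber_hi (h z) + C) - h z) (h z - h (fiber_lo (h z) - C)).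
exists eta => [|y yz]; first by rewrite lt_min !subr_gt0 up down.
rewrite lt_min => /andP[yup ydown].
rewrite ltNge; apply/negP; rewrite /fiber_length => long.
have [|zy|yz'] := ltgtP (h y) (h z) => [lyz||]; last exact: yz.
- have := fiber_lt (_ : h (fiber_hi (h y)) < h (fiber_lo (h z))).
  rewrite h_fiber_hi h_fiber_lo => /(_ lyz) hilo.
  have /dh.1 : fiber_lo (h y) <= fiber_lo (h z) - C by lra.
  by rewrite h_fiber_lo => ?; move: ydown; rewrite ltr0_norm ?subr_lt0//; lra.
- have := fiber_lt (_ : h (fiber_hi (h z)) < h (fiber_lo (h y))).
  rewrite h_fiber_hi h_fiber_lo => /(_ zy) hilo.
  have /dh.1 : fiber_hi (h z) + C <= fiber_hi (h y) by lra.
  by rewrite h_fiber_hi => ?; move: yup; rewrite gtr0_norm ?subr_gt0//; lra.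
Qed.

(** Otherwise [F] is constant between [x] and [x + 1], so [h] is constant there, and an
    orbit that starts in this interval must afterwards stay in the orbit of [x]
    under integer translations, where the values of [h] agree modulo [1]. *)
Lemma no_unit_jump x :
  exists y0 y1, [/\ y0 < x, x < y1 & F y1 - F y0 < 1].
Proof.
apply: contrapT => nojump.
have jump y0 y1 : y0 < x -> x < y1 -> F y0 + 1 <= F y1.
  move=> y0x xy1; rewrite -lerBrDl leNgt; apply/negP => lt1.
  by apply: nojump; exists y0, y1.
have Fle y y' : x < y < x + 1 -> x < y' < x + 1 -> F y <= F y'.
  move=> /andP[_ yx] /andP[xy' _].
  have := jump (y - 1) y' _ xy'; rewrite ltrBlDr yx => /(_ isT).
  by rewrite -dF.2 subrK.
have hle y y' : x < y < x + 1 -> x < y' < x + 1 -> h y <= h y'.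
  by move=> yi y'i; have := dh.1 _ _ (Fle _ _ yi y'i); rewrite !hF lerD2r.
pose w := x + 2^-1.
have wi : x < w < x + 1 by rewrite /w; apply/andP; split; lra.
have onZ n : (0 < n)%N -> iter n F w - x \is a Num.int.
  move=> n0; apply: contrapT => notint.
  pose m := Num.floor (iter n F w - x); pose v := iter n F w - m%:~R.
  have vi : x < v < x + 1.
    have := floor_itv (iter n F w - x); rewrite -/m intrD1 /v => /andP[].
    rewrite le_eqVlt => /orP[/eqP E|lo hi].
      by exfalso; apply: notint; rewrite -E intr_int.
    by apply/andP; split; lra.
  have hvw : h v = h w by apply/eqP; rewrite eq_le !hle.
  move: hvw; rewrite /v -intrN degree_oneZ// fiber_iter intrN => hvw.
  apply: (negP (irrational_mul_nint irr n0)).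
  by have -> : n%:R * rho = m%:~R by lra.
have : iter 1 F w - iter 2 F w \is a Num.int.
  have -> : iter 1 F w - iter 2 F w = (iter 1 F w - x) - (iter 2 F w - x) by ring.
  by rewrite rpredB ?onZ.
move=> /intrP[m Em]; have : iter 1 F w = iter 2 F w + m%:~R by rewrite -Em addrC subrK.
move=> /(congr1 h); rewrite degree_oneZ// !fiber_iter => Eh.
apply: (negP (irrational_mul_nint irr (isT : 0 < 1)%N)).
by have -> : 1%:R * rho = (- m)%:~R by rewrite intrN; lra.
Qed.

(** Points just outside the fiber of [z] are mapped outside the fiber of [F z],
    on the same side; since [F] is continuous at the end points of the first
    fiber, it maps them to the end points of the second one. The mean value
    theorem on the fiber then expresses the growth of its length as one value of
    the derivative. *)
Lemma fiber_step (D : R -> R) z :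
  (forall x, h x = h z -> is_derive x 1 F (D x)) ->
  0 < fiber_length (h z) -> 0 < fiber_length (h z + rho) ->
  exists x, [/\ h x = h z, 0 < D x &
    fiber_length (h z + rho) = D x * fiber_length (h z)].
Proof.
move=> FD len0 len1; rewrite -hF in len1 *.
have Fc x : h x = h z -> {for x, continuous F}.
  by move=> /FD [dx _]; exact/differentiable_continuous/derivable1_diffP.
have Flo : F (fiber_lo (h z)) = fiber_lo (h (F z)).
  apply/eqP; rewrite eq_le; apply/andP; split; last first.
    have <- : h (F (fiber_lo (h z))) = h (F z) by rewrite !hF h_fiber_lo.
    exact: fiber_lo_le.
  rewrite leNgt; apply/negP => lt1.
  have /(cvgr_gt _)/(_ _ lt1) := Fc _ (h_fiber_lo z).
  move=> /nbhs_ballP[e /= e0 ball1].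
  have := ball1 (fiber_lo (h z) - e / 2).
  rewrite /ball/= opprB addrC subrK gtr0_norm ?divr_gt0// => /(_ _)/ltW.
  move=> /(_ ltac:(lra))/dh.1; rewrite h_fiber_lo !hF lerD2r => zle.
  have /fiberP/andP[] : h (fiber_lo (h z) - e / 2) = h z.
    apply/eqP; rewrite eq_le zle andbT -[leRHS]h_fiber_lo dh.1// gerBl; lra.
  by lra.
have Fhi : F (fiber_hi (h z)) = fiber_hi (h (F z)).
  apply/eqP; rewrite eq_le; apply/andP; split.
    have <- : h (F (fiber_hi (h z))) = h (F z) by rewrite !hF h_fiber_hi.
    exact: fiber_le_hi.
  rewrite leNgt; apply/negP => lt1.
  have /(cvgr_lt _)/(_ _ lt1) := Fc _ (h_fiber_hi z).
  move=> /nbhs_ballP[e /= e0 ball1].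
  have := ball1 (fiber_hi (h z) + e / 2).
  rewrite /ball/= opprD addrA subrr sub0r normrN gtr0_norm ?divr_gt0// => /(_ _)/ltW.
  move=> /(_ ltac:(lra))/dh.1; rewrite h_fiber_hi !hF lerD2r => zge.
  have /fiberP/andP[] : h (fiber_hi (h z) + e / 2) = h z.
    apply/eqP; rewrite eq_le zge/= -[leLHS]h_fiber_hi dh.1// lerDl; lra.
  by lra.
have lohi : fiber_lo (h z) < fiber_hi (h z) by rewrite -subr_gt0.
have [x xi||x xi] := @MVT R F D _ _ lohi.
- apply: FD; apply/fiberP; move: xi; rewrite in_itv/= => /andP[? ?].
  by rewrite !ltW.
- apply: derivable_within_continuous => y; rewrite in_itv/= => /fiberP /FD.
  by case.
rewrite Flo Fhi => E; exists x; split=> //.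
  by apply/fiberP; move: xi; rewrite in_itv/= => /andP[? ?]; rewrite !ltW.
by move: len1; rewrite /fiber_length E pmulr_lgt0.
Qed.

End Fibers.

(** * Derivatives on the circle and on the line *)

Lemma cprojD_int (R : realType) (x : R) (m : int) : cproj (x + m%:~R) = cproj x.
Proof. by apply/cproj_eqP; rewrite addrAC subrr add0r intr_int. Qed.

Lemma cproj_eq_shift (R : realType) (x y : R) :
  cproj x = cproj y -> exists m : int, x = y + m%:~R.
Proof. by move=> /cproj_eqP/intrP[m E]; exists m; rewrite -E addrC subrK. Qed.

Lemma iter_lift (R : realType) (f : circle R -> circle R) (F : R -> R) n x :
  order_preserving_lift f F -> iter n f (cproj x) = cproj (iter n F x).
Proof. by move=> [_ _ Ff]; elim: n => //= n ->. Qed.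

(** A local expression [G] of [f] differs from the global lift [F] by an
    integer-valued function; since [G] is continuous and [F] does not jump by
    [1], this function is locally constant. *)
Lemma has_cderiv_lift (R : realType) (f : circle R -> circle R) (F h : R -> R)
    (rho : R) (x l : R) :
  order_preserving_lift f F -> degree_one h -> (forall x, h (F x) = h x + rho) ->
  @irrational R rho -> has_cderiv f (cproj x) l -> is_derive x 1 F l.
Proof.
move=> [Fmono F1 Ff] dh hF irr [x' [G [/cproj_eq_shift[k x'x] Gf dG]]].
have dF : degree_one F by split.
suff dFx' : is_derive x' 1 F l.
  have shiftF : F = (fun y => F (shift k%:~R y) - k%:~R).
    by apply/funext => y /=; rewrite degree_oneZ// addrK.
  rewrite shiftF -[l]subr0 -[X in X - 0]mulr1.
  apply: is_deriveB; apply: (@is_derive1_comp _ F (shift k%:~R) x l 1).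
    by rewrite /= -x'x.
  exact: is_derive_shift.
have [y0 [y1 [y0x' x'y1 jump]]] := no_unit_jump dF dh hF irr x'.
have Gc : {for x', continuous G}.
  by case: dG => dG _; exact/differentiable_continuous/derivable1_diffP.
have dG' : is_derive x' 1 (fun y => G y - (G x' - F x')) l.
  by rewrite -[l]subr0; apply: is_deriveB.
apply: (near_eq_is_derive _ dG').
have e0 : 0 < 1 - (F y1 - F y0) by lra.
near=> y.
have /cproj_eqP GF : cproj (G y) = cproj (F y) by rewrite Ff; near: y.
have /cproj_eqP GF' : cproj (G x') = cproj (F x').
  by rewrite Ff; exact: nbhs_singleton Gf.
have Gy : `|G x' - G y| < 1 - (F y1 - F y0).
  by near: y; move/cvgr_dist_lt: Gc => /(_ _ e0).
have y0y : F y0 <= F y by apply/Fmono/ltW; near: y; exact: lt_nbhsr.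
have yy1 : F y <= F y1 by apply/Fmono/ltW; near: y; exact: lt_nbhsl.
have /Fmono ? := ltW y0x'; have /Fmono ? := ltW x'y1.
have : (G y - F y) - (G x' - F x') = 0.
  apply: int_lt1_eq0; first exact: rpredB.
  by move: Gy; rewrite !ltr_norml => /andP[? ?]; apply/andP; split; lra.
by lra.
Unshelve. all: by end_near. Qed.

Lemma cderivable_lift (R : realType) (f : circle R -> circle R) (F h : R -> R)
    (rho : R) (x : R) :
  order_preserving_lift f F -> degree_one h -> (forall x, h (F x) = h x + rho) ->
  @irrational R rho -> cderivable f (cproj x) ->
  is_derive x 1 F (cderiv f (cproj x)).
Proof.
move=> fF dh hF irr df; apply: (has_cderiv_lift fF dh hF irr).
exact: (xgetPex 0 df).
Qed.

(** * Comparison of sums along two orbits *)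

(** Since [|q rho - p| < 1/q] with [p] prime to [q], the points
    [c, c + rho, ..., c + (q-1) rho] lie modulo [1] one by one next to the points
    of the arithmetic progression of step [1/q]; the index [i] of the point next
    to [c + j/q] solves [i p = j] modulo [q]. The offset [s] chooses the start of
    the enumeration. *)
Lemma rotation_bins (R : realType) (h : R -> R) (rho c : R) (p : int) (q : nat)
    (x : nat -> R) (s : int) :
  degree_one h -> (0 < q)%N -> coprimez p q ->
  `|q%:R * rho - p%:~R| < q%:R^-1 ->
  (forall i, (i < q)%N -> h (x i) = c + i%:R * rho) ->
  exists X : nat -> R,
    [/\ forall j, `|h (X j) - (c + (j%:R + s%:~R) / q%:R)| < q%:R^-1,
        forall j, exists i (m : int), (i < q)%N /\ X j = x i + m%:~R &
        forall G : R -> R, (forall y (m : int), G (y + m%:~R) = G y) ->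
          \sum_(0 <= j < q) G (X j) = \sum_(0 <= i < q) G (x i)].
Proof.
move=> dh q0 cop close hx; have [u [v uv]] := Bezoutz p q.
have {}uv : u * p + v * q = 1 by rewrite uv; exact/eqP.
have qZ0 : (q : int) != 0 by rewrite eqz_nat -lt0n.
have qR0 : q%:R != 0 :> R by rewrite pnatr_eq0 -lt0n.
pose idx (j : nat) := (((j%:Z + s) * u) %% q)%Z.
have idx0 j : 0 <= idx j by exact: modz_ge0.
have idxq j : idx j < q by rewrite ltz_pmod.
pose i j := `|idx j|%N.
have iE j : (i j : int) = idx j by rewrite gez0_abs.
have iq j : (i j < q)%N by rewrite -ltz_nat iE.
have ip j : exists m : int, j%:Z + s = (i j)%:Z * p + m * q.
  exists ((((j%:Z + s) * u) %/ q)%Z * p + (j%:Z + s) * v).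
  rewrite iE /idx; have := divz_eq ((j%:Z + s) * u) q.
  move: (_ %/ _)%Z (_ %% _)%Z => a b E.
  by rewrite -[LHS]mulr1 -uv mulrDr mulrA E; ring.
have [m mE] := choice ip.
exists (fun j => x (i j) + (m j)%:~R); split=> [j|j|G Gper].
- rewrite degree_oneZ// hx//.
  have E : j%:R + s%:~R = (i j)%:R * p%:~R + (m j)%:~R * q%:R :> R.
    by have /(congr1 (fun z : int => z%:~R : R)) := mE j; rewrite !(intrD, intrM).
  rewrite E; set e := _ - _.
  have -> : e = (i j)%:R / q%:R * (q%:R * rho - p%:~R).
    by rewrite /e; field.
  rewrite normrM; apply: le_lt_trans close; rewrite ler_piMl//.
  by rewrite ger0_norm ?divr_ge0// ler_pdivrMr ?ltr0n// mul1r ler_nat ltnW.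
- by exists (i j), (m j).
- under eq_bigr do rewrite Gper.
  rewrite !big_mkord; pose io (j : 'I_q) := Ordinal (iq j).
  have io_inj : injective io.
    move=> j k /(congr1 val)/= ijk; apply: val_inj; apply/eqP.
    have : (q %| (j%:Z - k%:Z))%Z.
      have -> : j%:Z - k%:Z = (m j - m k) * q.
        have -> : j%:Z - k%:Z = (j%:Z + s) - (k%:Z + s) by ring.
        by rewrite !mE ijk; ring.
      exact: dvdz_mull.
    by rewrite -eqz_mod_dvd !modz_small ?ltz_nat ?ltn_ord.
  by rewrite [RHS](reindex_inj io_inj).
Qed.

Section Variation.
Variables (R : realType) (U : set (circle R)) (g : circle R -> R) (V : R).
Hypothesis varV : forall n t, ordered_points U n t ->
  \sum_(1 <= i < n.+1) `|g (cproj (t i)) - g (cproj (t i.-1))| <= V.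

(** Keeping track of the first and last points lets an ordered set of points be
    built one point at a time. *)
Definition chain (x y s : R) : Prop := exists (n : nat) (t : nat -> R),
  [/\ t 0%N = x /\ t n = y, forall i, (i < n)%N -> t i < t i.+1,
      forall i, (i <= n)%N -> U (cproj (t i)) &
      s = \sum_(1 <= i < n.+1) `|g (cproj (t i)) - g (cproj (t i.-1))|].

Lemma chain_le x y s : chain x y s -> y < x + 1 -> s <= V.
Proof. by move=> [n [t [[<- <-] tlt tU ->]]] yx; exact: varV. Qed.

Lemma chain0 x : U (cproj x) -> chain x x 0.
Proof. by move=> Ux; exists 0%N, (fun=> x); split=> //; rewrite big_geq. Qed.

Lemma chain_rcons x y z s : chain x y s -> y <= z -> U (cproj z) ->
  chain x z (s + `|g (cproj z) - g (cproj y)|).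
Proof.
move=> xys; rewrite le_eqVlt => /orP[/eqP <- _|yz Uz].
  by rewrite subrr normr0 addr0.
case: xys => n [t [[<- tn] tlt tU ->]].
exists n.+1, (fun i => if (i <= n)%N then t i else z); split.
- by rewrite leq0n ltnn.
- move=> i; rewrite ltnS => ilen; rewrite ilen; case: ltnP => [|nlei]; first exact: tlt.
  by have -> : i = n by [apply/eqP; rewrite eqn_leq ilen]; rewrite tn.
- by move=> i _; case: ifP => // ilen; exact: tU.
rewrite [RHS]big_nat_recr//= ltnn leqnn tn; congr (_ + _).
apply: eq_big_nat => i /andP[_]; rewrite ltnS => ilen.
by rewrite ilen (leq_trans (leq_pred i) ilen).
Qed.

Lemma chain_pair x y s a b : chain x y s -> y <= Num.min a b ->
    U (cproj a) -> U (cproj b) ->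
  exists2 s', s + `|g (cproj a) - g (cproj b)| <= s' & chain x (Num.max a b) s'.
Proof.
wlog ab : a b / a <= b => [wl|] xys.
  case/orP: (le_total a b) => ?; first exact: wl.
  by rewrite minC maxC distrC => yab Ua Ub; exact: wl.
rewrite min_l// max_r// => ya Ua Ub.
exists (s + `|g (cproj a) - g (cproj y)| + `|g (cproj b) - g (cproj a)|).
  by rewrite [in leRHS]distrC (distrC (g (cproj b))) lerD2r lerDl.
exact: chain_rcons (chain_rcons xys ya Ua) ab Ub.
Qed.

Lemma oscillation_le x y : U (cproj x) -> U (cproj y) ->
  `|g (cproj x) - g (cproj y)| <= V.
Proof.
move=> Ux Uy; pose m := - Num.floor (y - x); pose y' := y + m%:~R.
have Uy' : U (cproj y') by rewrite cprojD_int.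
have /andP[xy' y'x] : x <= y' < x + 1.
  have := floor_itv (y - x); rewrite intrD1 /y' /m intrN => /andP[? ?].
  by apply/andP; split; lra.
have := chain_le (chain_rcons (chain0 Ux) xy' Uy') y'x.
by rewrite add0r cprojD_int distrC.
Qed.

(** Pairs that sit in successive windows, all within one turn, form one ordered
    set of points of the circle. *)
Lemma sum_windows_le (h : R -> R) (w a b : nat -> R) (n : nat) :
  degree_one h -> (0 < n)%N -> w n <= w 0%N + 1 ->
  (forall k, U (cproj (a k)) /\ w k < h (a k) < w k.+1) ->
  (forall k, U (cproj (b k)) /\ w k < h (b k) < w k.+1) ->
  \sum_(0 <= k < n) `|g (cproj (a k)) - g (cproj (b k))| <= V.
Proof.
move=> dh; case: n => // n _ turn aw bw.
have wmin k : w k < h (Num.min (a k) (b k)).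
  by have [[_ /andP[? _]] [_ /andP[? _]]] := (aw k, bw k); case: (leP (a k) (b k)).
have wmax k : h (Num.max (a k) (b k)) < w k.+1.
  by have [[_ /andP[_ ?]] [_ /andP[_ ?]]] := (aw k, bw k); case: (leP (a k) (b k)).
have [s ss schain] : exists2 s,
    \sum_(0 <= k < n.+1) `|g (cproj (a k)) - g (cproj (b k))| <= s &
    chain (Num.min (a 0%N) (b 0%N)) (Num.max (a n) (b n)) s.
  elim: n {turn} => [|n [s ss schain]].
    have Umin : U (cproj (Num.min (a 0%N) (b 0%N))).
      by case: (leP (a 0%N) (b 0%N)) => _; [exact: (aw _).1|exact: (bw _).1].
    have [s] := chain_pair (chain0 Umin) (lexx _) (aw _).1 (bw _).1.
    by rewrite add0r => ? ?; exists s => //; rewrite big_nat1.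
  have [|s' ss' schain'] := chain_pair schain (_ : _ <= Num.min (a n.+1) (b n.+1))
    (aw _).1 (bw _).1.
    by apply/ltW/(fiber_lt dh)/(lt_trans (wmax n)).
  by exists s' => //; rewrite big_nat_recr//=; apply: le_trans ss'; rewrite lerD2r.
apply: le_trans ss (chain_le schain _).
apply: (fiber_lt dh); rewrite dh.2 (lt_le_trans (wmax n))//.
by rewrite (le_trans turn)// lerD2r ltW.
Qed.

(** The indices below [3 (q %/ 3)] split into three residue classes modulo [3];
    at most two indices remain. *)
Lemma sum_mod3_le (a : nat -> R) (q : nat) (B : R) :
  (forall j n, (3 * n <= q)%N -> \sum_(0 <= k < n) a (j + 3 * k)%N <= B) ->
  (forall j, a j <= B) -> 0 <= B -> \sum_(0 <= j < q) a j <= 5 * B.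
Proof.
move=> stepB aB B0.
have split3 n : \sum_(0 <= j < 3 * n) a j =
    \sum_(0 <= k < n) a (0 + 3 * k)%N + \sum_(0 <= k < n) a (1 + 3 * k)%N
    + \sum_(0 <= k < n) a (2 + 3 * k)%N.
  elim: n => [|n IH]; first by rewrite !big_geq// !addr0.
  have -> : (3 * n.+1 = (3 * n).+3)%N by lia.
  rewrite !big_nat_recr//= IH add0n add1n add2n; ring.
have [n nq qE] : exists2 n, (3 * n <= q)%N &
    (q = 3 * n \/ q = (3 * n).+1 \/ q = (3 * n).+2)%N.
  by exists (q %/ 3)%N; lia.
have := stepB 0%N _ nq; have := stepB 1%N _ nq; have := stepB 2%N _ nq.
have := split3 n; have := aB (3 * n)%N; have := aB (3 * n).+1.
move: (3 * n)%N qE => N; case=> [|[|]] ->; rewrite ?big_nat_recr//=; lra.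
Qed.

(** Matching each point of the first orbit with the point of the second orbit
    in the same bin makes pairs of which every third one lies in a separate
    window of length [3/q]. *)
Lemma rotation_sums_close (h : R -> R) (rho c d : R) (p : int) (q : nat)
    (x y : nat -> R) :
  degree_one h -> (0 < q)%N -> coprimez p q ->
  `|q%:R * rho - p%:~R| < q%:R^-1 ->
  (forall i, U (cproj (x i)) /\ h (x i) = c + i%:R * rho) ->
  (forall i, U (cproj (y i)) /\ h (y i) = d - i%:R * rho) ->
  `|\sum_(0 <= i < q) g (cproj (x i)) - \sum_(0 <= i < q) g (cproj (y i))|
    <= 5 * V.
Proof.
move=> dh q0 cop close hx hy; have qR0 : 0 < q%:R :> R by rewrite ltr0n.
have [X [Xbin Xx Xsum]] := rotation_bins 0 dh q0 cop close (fun i _ => (hx i).2).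
(* the bins of [y] are renumbered so that bin [j] starts just below [c + j/q] *)
pose s := Num.floor (q%:R * (c - d)).
have [Y [Ybin Yy Ysum]] : exists Y : nat -> R,
    [/\ forall j, `|h (Y j) - (d + (j%:R + s%:~R) / q%:R)| < q%:R^-1,
        forall j, exists i (m : int), (i < q)%N /\ Y j = y i + m%:~R &
        forall G : R -> R, (forall y (m : int), G (y + m%:~R) = G y) ->
          \sum_(0 <= j < q) G (Y j) = \sum_(0 <= i < q) G (y i)].
  apply: (@rotation_bins _ h (- rho) d (- p)) => //.
  - by rewrite /coprimez /gcdz abszN.
  - by rewrite intrN mulrN -opprD normrN.
  - by move=> i _; rewrite (hy i).2 mulrN.
have UX j : U (cproj (X j)).
  by have [i [m [_ ->]]] := Xx j; rewrite cprojD_int; exact: (hx i).1.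
have UY j : U (cproj (Y j)).
  by have [i [m [_ ->]]] := Yy j; rewrite cprojD_int; exact: (hy i).1.
have gper z (m : int) : g (cproj (z + m%:~R)) = g (cproj z) by rewrite cprojD_int.
rewrite -(Xsum (g \o @cproj R))// -(Ysum (g \o @cproj R))// -sumrB /=.
apply: le_trans (ler_norm_sum _ _ _) _.
have V0 : 0 <= V by rewrite (le_trans _ (oscillation_le (UX 0%N) (UX 0%N))).
apply: sum_mod3_le => // [j n nq|j]; last exact: oscillation_le.
case: n nq => [|n] nq; first by rewrite big_geq.
(* [X j] is within [1/q] of [c + j/q], and rounding [s] down puts [Y j] up to
   [1/q] further to the left: hence windows from [-2/q] to [+1/q]. *)
pose w (k : nat) := c + (j%:R + 3 * k%:R - 2) / q%:R.
have wS k : w k.+1 = c + (j%:R + 3 * k%:R + 1) / q%:R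
  by rewrite /w -natr1; congr (_ + _ / _); ring.
have jk k : (j + 3 * k)%:R = j%:R + 3 * k%:R :> R by rewrite natrD natrM.
apply: (@sum_windows_le h w) => // [|k|k].
- have -> : w n.+1 = w 0%N + (3 * n.+1)%:R / q%:R.
    by rewrite /w natrM mulr0; ring.
  by rewrite lerD2l ler_pdivrMr// mul1r ler_nat.
- split=> //; rewrite wS /w; have := Xbin (j + 3 * k)%N.
  rewrite addr0 jk ltr_norml => /andP[? ?].
  by apply/andP; split; lra.
- split=> //; rewrite wS /w; have := Ybin (j + 3 * k)%N.
  have : s%:~R / q%:R <= c - d by rewrite ler_pdivrMr// mulrC floor_le.
  have : c - d < (s%:~R + 1) / q%:R by rewrite ltr_pdivlMr// mulrC -intrD1 floorD1_gt.
  rewrite jk ltr_norml => ? ? /andP[? ?].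
  by apply/andP; split; lra.
Qed.

End Variation.

(** * Wandering intervals and fibers *)

Lemma irrationalN (R : realType) (rho : R) :
  @irrational R rho -> @irrational R (- rho).
Proof.
by apply: contra_not => -[q _ qE]; exists (- q) => //; rewrite rmorphN/= qE opprK.
Qed.

Lemma irrationalD_int (R : realType) (rho : R) (m : int) :
  @irrational R rho -> @irrational R (rho + m%:~R).
Proof.
apply: contra_not => -[q _ qE]; exists (q - m%:~R) => //.
by rewrite rmorphB/= ratr_int qE addrK.
Qed.

(** Two points rather than a positive length, because [fiber_lo] and [fiber_hi]
    describe a fiber only once it is known to be nonempty. *)
Definition fat_fiber (R : realType) (h : R -> R) (t : R) : Prop :=
  exists x y, [/\ h x = t, h y = t & x <> y].

Section WanderingFibers.
Variables (R : realType) (f : circle R -> circle R) (F h : R -> R) (rho : R).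
Hypotheses (fF : order_preserving_lift f F) (dh : degree_one h).
Hypotheses (hF : forall x, h (F x) = h x + rho) (irr : @irrational R rho).

(** If [h] took two values on [J], the orbit of one of its points would come
    back to [J] by minimality of the rotation. *)
Lemma nonreturning_in_fiber (J : set R) (x y : R) :
  is_interval J ->
  (forall n p, (0 < n)%N -> (@cproj R @` J) p -> ~ (@cproj R @` J) (iter n f p)) ->
  J x -> J y -> h x = h y.
Proof.
move=> Jitv noreturn; wlog : x y / h x < h y => [wl Jx Jy|hxy Jx Jy].
  by have [/wl|/wl xy|] := ltgtP (h x) (h y); [exact|exact/esym/xy|].
have [n [m [z [n0 zxy /andP[xw wy]]]]] := orbit_between dh hF irr hxy.
have Jz : J z by case: zxy => ->.
case: (noreturn n (cproj z) n0); first by exists z.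
exists (iter n F z + m%:~R); last by rewrite cprojD_int (iter_lift _ _ fF).
by apply: (Jitv x y) => //; apply/andP; split; apply/ltW/(fiber_lt dh).
Qed.

Lemma fat_fiber_length_gt0 (t : R) : fat_fiber h t -> 0 < fiber_length h t.
Proof.
move=> [x [y [hx hy xy]]]; rewrite -hx.
by apply: (fiber_length_gt0 dh _ xy); rewrite hx hy.
Qed.

(** The images of two points of [I] that stay distinct under [f^k] are two points
    of the fiber over the [k]-th translate of the value taken by [h] on [I]. *)
Lemma forward_wandering_fat_fibers (I : set (circle R)) :
  forward_wandering f I -> exists c, forall k, fat_fiber h (c + k%:R * rho).
Proof.
move=> [Anontriv Adisj _].
have [[J [Jitv IJ]] [p0 [_ [Ip0 _ _]]]] := Anontriv 0%N.
have fwd0 : fwd f I 0 = I by rewrite /fwd/= image_id.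
rewrite fwd0 in IJ Ip0.
have hJ x y : J x -> J y -> h x = h y.
  apply: nonreturning_in_fiber => // n p n0; rewrite -IJ => Ip Inp.
  have n00 : 0%N = n.
    apply: Adisj => //; exists (iter n f p); rewrite fwd0.
    by split=> //; exists p.
  by rewrite -n00 in n0.
move: Ip0; rewrite IJ => -[z Jz _]; exists (h z) => k.
have [_ [_ [_ [[p Ip <-] [q Iq <-] pq]]]] := Anontriv k.
move: Ip Iq pq; rewrite IJ => -[x Jx <-] [y Jy <-]; rewrite !(iter_lift _ _ fF) => xy.
exists (iter k F x), (iter k F y); split.
- by rewrite (fiber_iter hF) (hJ x z).
- by rewrite (fiber_iter hF) (hJ y z).
- by move=> E; apply: xy; rewrite E.
Qed.

(** A point of [f^-k(I)] has a lift that [F^k] sends exactly into the interval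
    of the line that lifts [I]; this determines the value of [h] there. *)
Lemma backward_wandering_fat_fibers (I : set (circle R)) :
  backward_wandering f I -> exists c, forall k, fat_fiber h (c + k%:R * - rho).
Proof.
move=> [Anontriv Adisj _].
have [[J [Jitv IJ]] [p0 [_ [Ip0 _ _]]]] := Anontriv 0%N.
have bwd0 : bwd f I 0 = I by [].
rewrite bwd0 in IJ Ip0.
have hJ x y : J x -> J y -> h x = h y.
  apply: nonreturning_in_fiber => // n p n0; rewrite -IJ => Ip Inp.
  have n00 : 0%N = n by apply: Adisj => //; exists p; rewrite bwd0.
  by rewrite -n00 in n0.
move: Ip0; rewrite IJ => -[z Jz _]; exists (h z) => k.
have lift p : bwd f I k p -> exists2 x, cproj x = p & h x = h z + k%:R * - rho.
  have [x <-] := cproj_surj p; rewrite /bwd/= (iter_lift _ _ fF) IJ => -[a Ja].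
  move=> /esym/cproj_eq_shift[m xa]; exists (x + (- m)%:~R); first exact: cprojD_int.
  have -> : h z = h a by exact: hJ.
  have := fiber_iter hF k x; rewrite xa !degree_oneZ// intrN; lra.
have [_ [p [q [/lift[x <- hx] /lift[y <- hy] xy]]]] := Anontriv k.
by exists x, y; split=> // E; apply: xy; rewrite E.
Qed.

End WanderingFibers.

Lemma finite_set_uniform_bound (T : choiceType) (E : set T) (P : T -> nat -> Prop) :
  finite_set E -> (forall e, E e -> exists K, forall k, (K <= k)%N -> P e k) ->
  exists K, forall e k, E e -> (K <= k)%N -> P e k.
Proof.
move=> /finite_seqP[s ->]; elim: s => [_|a s IH sP]; first by exists 0%N.
have [K1 aK1] := sP a (mem_head _ _).
have [|K2 sK2] := IH; first by move=> e es; apply: sP; rewrite /= inE es orbT.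
exists (maxn K1 K2) => e k /=; rewrite inE geq_max => /orP[/eqP ->|es] /andP[? ?].
- exact: aK1.
- exact: sK2.
Qed.

(** Fibers along an orbit of the rotation are disjoint modulo [1], so a given
    point of the circle meets only one of them. *)
Lemma fibers_avoid_finite_set (R : realType) (h : R -> R) (sigma c : R)
    (E : set (circle R)) :
  degree_one h -> @irrational R sigma -> finite_set E ->
  exists K, forall k x, (K <= k)%N -> h x = c + k%:R * sigma -> ~ E (cproj x).
Proof.
move=> dh irr Efin.
have [|K KP] := finite_set_uniform_bound Efin (P := fun e k =>
    forall x, h x = c + k%:R * sigma -> cproj x <> e).
  move=> e _; have [[k [x [hx xe]]]|none] := pselect (exists k x,
      h x = c + k%:R * sigma /\ cproj x = e); last first.
    by exists 0%N => k _ x hx xe; apply: none; exists k, x.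
  exists k.+1 => l kl y hy; rewrite -xe => /cproj_eq_shift[m yx].
  suff kl' : l = k by rewrite kl' ltnn in kl.
  apply: (irrational_inj irr); apply/intrP; exists m.
  by move: hy; rewrite yx degree_oneZ// hx; lra.
by exists K => k x Kk hx Ex; exact: (KP _ k Ex Kk x hx).
Qed.

Lemma fat_fibers_eventually_smooth (R : realType) (f : circle R -> circle R)
    (h : R -> R) (sigma c0 : R) :
  degree_one h -> @irrational R sigma -> C1_except_finite f ->
  (forall k, fat_fiber h (c0 + k%:R * sigma)) ->
  exists c, forall k, fat_fiber h (c + k%:R * sigma) /\
    forall x, h x = c + k%:R * sigma -> cderivable f (cproj x).
Proof.
move=> dh irr [E [Efin EC1]] fat0.
have [K EK] := fibers_avoid_finite_set c0 dh irr Efin.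
exists (c0 + K%:R * sigma) => k.
have -> : c0 + K%:R * sigma + k%:R * sigma = c0 + (K + k)%:R * sigma.
  by rewrite natrD; ring.
split=> // x hx.
by have [] := EC1 _ (EK _ _ (leq_addr k K) hx).
Qed.

Lemma cvariation_bound (R : realType) (U : set (circle R)) (g : circle R -> R) :
  (cvariation U g < +oo)%E ->
  exists V : R, forall n t, ordered_points U n t ->
    \sum_(1 <= i < n.+1) `|g (cproj (t i)) - g (cproj (t i.-1))| <= V.
Proof.
rewrite /cvariation; set A := [set v | _].
have memA n t : ordered_points U n t ->
    A (\sum_(1 <= i < n.+1) `|g (cproj (t i)) - g (cproj (t i.-1))|)%:E.
  by move=> Ut; exists n, t.
case supA : (ereal_sup A) => [V||]// _.
- exists V => n t /memA At; rewrite -lee_fin -supA; exact: ereal_sup_ubound.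
(* the supremum is [-oo] only if there is no ordered set of points at all *)
- exists 0 => n t /memA At; have := ereal_sup_ubound At.
  by rewrite supA leeNy_eq.
Qed.

(** * Lengths of fibers *)

Section Lengths.
Variables (R : realType) (f : circle R -> circle R) (F h : R -> R) (rho : R).
Hypotheses (fF : order_preserving_lift f F) (dh : degree_one h).
Hypotheses (hF : forall x, h (F x) = h x + rho) (irr : @irrational R rho).

Lemma ln_fiber_length_step (t : R) :
  (forall x, h x = t -> cderivable f (cproj x)) ->
  fat_fiber h t -> fat_fiber h (t + rho) ->
  exists x, [/\ supp_cderiv f (cproj x), h x = t &
    ln (fiber_length h (t + rho)) - ln (fiber_length h t) =
    ln (cderiv f (cproj x))].
Proof.
move=> ft tfat /(fat_fiber_length_gt0 dh) t1.
have t0 := fat_fiber_length_gt0 dh tfat.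
have [z [_ [hz _ _]]] := tfat; rewrite -hz in t0 t1 *.
have dz x : h x = h z -> is_derive x 1 F (cderiv f (cproj x)).
  by rewrite hz => /ft; exact: cderivable_lift fF dh hF irr.
have [x [hx D0 lenE]] := fiber_step dh hF irr dz t0 t1.
exists x; split=> //.
  by split; [apply: ft; rewrite hx|rewrite gt_eqF].
by rewrite lenE lnM ?posrE// addrK.
Qed.

(** Along [q] steps the logarithm of the length of a fiber changes by a sum of
    [q] values of [ln Df]. The sums over the fibers [c + k rho] and over the
    fibers [d - k rho] differ by at most [5 V], so that
    [length (c + q rho) * length (d - q rho)] is bounded below, while the second
    factor is at most [1] and the first one is arbitrarily small when [q rho]
    returns close to [0] modulo [1]. *)
Lemma no_opposite_fat_fibers (V c d : R) :
  (forall n t, ordered_points (supp_cderiv f) n t ->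
    \sum_(1 <= i < n.+1)
      `|ln (cderiv f (cproj (t i))) - ln (cderiv f (cproj (t i.-1)))| <= V) ->
  (forall k, fat_fiber h (c + k%:R * rho) /\
    forall x, h x = c + k%:R * rho -> cderivable f (cproj x)) ->
  ~ (forall k, fat_fiber h (d + k%:R * - rho) /\
    forall x, h x = d + k%:R * - rho -> cderivable f (cproj x)).
Proof.
pose g p := ln (cderiv f p); pose len := fiber_length h => varV cfat dfat.
have /choice[x xP] : forall k, exists x,
    [/\ supp_cderiv f (cproj x), h x = c + k%:R * rho &
    ln (len (c + k.+1%:R * rho)) - ln (len (c + k%:R * rho)) = g (cproj x)].
  move=> k; have := (cfat k.+1).1.
  have -> : c + k.+1%:R * rho = c + k%:R * rho + rho by rewrite -natr1; ring.
  exact: ln_fiber_length_step (cfat k).2 (cfat k).1.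
have /choice[y yP] : forall k, exists y,
    [/\ supp_cderiv f (cproj y), h y = d - rho - k%:R * rho &
    ln (len (d + k%:R * - rho)) - ln (len (d + k.+1%:R * - rho)) = g (cproj y)].
  move=> k; have := (dfat k).1.
  have -> : d - rho - k%:R * rho = d + k.+1%:R * - rho by rewrite -natr1; ring.
  have -> : d + k%:R * - rho = d + k.+1%:R * - rho + rho by rewrite -natr1; ring.
  exact: ln_fiber_length_step (dfat k.+1).2 (dfat k.+1).1.
have sumx q : \sum_(0 <= k < q) g (cproj (x k)) =
    ln (len (c + q%:R * rho)) - ln (len c).
  under eq_bigr do rewrite -(let: And3 _ _ e := xP _ in e).
  by rewrite telescope_sumr// mul0r addr0.
have sumy q : \sum_(0 <= k < q) g (cproj (y k)) =
    ln (len d) - ln (len (d + q%:R * - rho)).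
  under eq_bigr do rewrite -(let: And3 _ _ e := yP _ in e) -opprB.
  by rewrite sumrN telescope_sumr// mul0r addr0 opprB.
have len_gt0 t : fat_fiber h t -> 0 < len t by exact: fat_fiber_length_gt0.
have c_gt0 : 0 < len c by have := len_gt0 _ (cfat 0%N).1; rewrite mul0r addr0.
have d_gt0 : 0 < len d by have := len_gt0 _ (dfat 0%N).1; rewrite mul0r addr0.
pose C := len c * len d * expR (- (5 * V)).
have C0 : 0 < C by rewrite !mulr_gt0// expR_gt0.
have [z [_ [hz _ _]]] := (cfat 0%N).1; rewrite mul0r addr0 in hz.
have [eta eta0 short] := near_fiber_short dh hF irr z C0.
have [q [p [q0 cop close ret]]] := dirichlet rho eta0.
have [v [_ [hv _ _]]] := (cfat q).1; have [w [_ [hw _ _]]] := (dfat q).1.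
have lenC : len (c + q%:R * rho) < C.
  rewrite -hv /len -(fiber_lengthD_int dh hF irr v (- p)) -degree_oneZ//.
  have vz : h (v + (- p)%:~R) - h z = q%:R * rho - p%:~R.
    by rewrite degree_oneZ// hv hz intrN; ring.
  apply: short; last by rewrite vz.
  move=> /eqP; rewrite -subr_eq0 vz subr_eq0 => /eqP qrho.
  by have /negP := irrational_mul_nint irr q0; apply; rewrite qrho intr_int.
have len1 : ln (len (d + q%:R * - rho)) <= 0.
  by rewrite -hw; apply: ln_le0; exact: fiber_length_le1 dh hF irr w.
have xh k : supp_cderiv f (cproj (x k)) /\ h (x k) = c + k%:R * rho.
  by have [] := xP k.
have yh k : supp_cderiv f (cproj (y k)) /\ h (y k) = d - rho - k%:R * rho.
  by have [] := yP k.
have := rotation_sums_close (g := g) varV dh q0 cop close xh yh.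
rewrite sumx sumy ler_norml => /andP[lower _].
have : ln (len (c + q%:R * rho)) < ln C.
  by rewrite ltr_ln ?posrE//; exact: len_gt0 (cfat q).1.
by rewrite /C !lnM ?posrE ?mulr_gt0 ?expR_gt0// expRK; lra.
Qed.

End Lengths.

Theorem theorem1 (R : realType) (f : circle R -> circle R) (rho : R)
  (hf : order_preserving f)
  (hrho : is_rotation_number f (cproj rho))
  (hbt : bounded_type rho)
  (hC1 : C1_except_finite f)
  (hvar : (cvariation (supp_cderiv f) (fun p => ln (cderiv f p)) < +oo)%E) :
  (~ exists I : set (circle R), forward_wandering f I) \/
  (~ exists I : set (circle R), backward_wandering f I).
Proof.
apply/not_andP => -[[I Ifwd] [J Jbwd]].
have [F [r [fF Fr /cproj_eq_shift[m rE]]]] := hrho.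
have irr : @irrational R r by rewrite rE; apply: irrationalD_int; case: hbt.
have [h [dh hF]] : exists h, degree_one h /\ forall x, h (F x) = h x + r.
  by apply: rotation_semiconjugacy => //; case: fF.
have [V varV] := cvariation_bound hvar.
have [c0 cfat0] := forward_wandering_fat_fibers fF dh hF irr Ifwd.
have [d0 dfat0] := backward_wandering_fat_fibers fF dh hF irr Jbwd.
have [c cfat] := fat_fibers_eventually_smooth dh irr hC1 cfat0.
have [d dfat] := fat_fibers_eventually_smooth dh (irrationalN irr) hC1 dfat0.
exact: (no_opposite_fat_fibers fF dh hF irr varV cfat dfat).
Qed.
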